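(* Let $n\ge 1$, let $B = GL(n)\ltimes(V\oplus V^* )$ with $V=\mathbb{C}^n$, let $\mathfrak{b}$ be its Lie algebra, and identify $\mathfrak{b}^*$ with $\mathfrak{gl}(n)\times V^*\times V$. For $0\le k\le n-1$ define $F_k:\mathfrak{b}^*\to\mathbb{C}$ by $$F_k(y,w^*,\xi) = w^*B_k(y)\xi .$$ Then: (1) The functions $F_0,\dots,F_{n-1}$ are polynomial functions on $\mathfrak{b}^*$ that are invariant under the coadjoint action $Ad^*(B)$, and they are algebraically independent. (2) $Y(\mathfrak{b})=\mathbb{C}[F_0,\dots,F_{n-1}]$, i.e. $Y(\mathfrak{b})$ is the polynomial algebra generated by $F_0,\dots,F_{n-1}$.
   Context: The base field is $\mathbb{C}$. $V=\mathbb{C}^n$ is identified with the column matrices $M_{n,1}$ and $V^*$ with the row matrices $M_{1,n}$; products such as $w^*B_k(y)\xi$ are matrix products. For $x\in M_n(\mathbb{C})$ define $p_1(x),\dots,p_n(x)$ by $\det(tI_n-x)=t^n-p_1(x)t^{n-1}-p_2(x)t^{n-2}-\cdots-p_n(x)$, and set $B_0(x)=I_n$ and $B_k(x)=x^k-p_1(x)x^{k-1}-\cdots-p_k(x)I_n$ for $1\le k\le n-1$. The group $B$ is the set $GL(n)\times V\times V^*$ with the semidirect product law $(g,u,v^* )(g',u',v'^* )=(gg',\,u+gu',\,v^*+v'^*g^{-1})$, associated with the representation $g\cdot(u,v^* )=(gu,v^*g^{-1})$. Its Lie algebra is $\mathfrak{b}=\mathfrak{gl}(n)\times V\times V^*$,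 the semidirect product of $\mathfrak{gl}(n)$ by the abelian ideal $V\oplus V^*$, with $[(x,0,0),(0,u,v^* )]=(0,xu,-v^*x)$. The dual $\mathfrak{b}^*$ is identified with $\mathfrak{gl}(n)\times V^*\times V$ through the pairing $\langle (y,w^*,\xi),(x,u,v^* )\rangle=\operatorname{tr}(yx)+w^*u+v^*\xi$. The coadjoint action is $\langle Ad^*(b)\ell,X\rangle=\langle\ell,Ad(b^{-1})X\rangle$ for $b\in B$, $\ell\in\mathfrak{b}^*$, $X\in\mathfrak{b}$. $Y(\mathfrak{b})$ denotes the algebra of invariants of $\mathfrak{b}$ in the symmetric algebra $S(\mathfrak{b})$. Here $S(\mathfrak{b})$ is identified with the algebra of polynomial functions on $\mathfrak{b}^*$, and since $B$ is connected, $Y(\mathfrak{b})$ is the algebra of $Ad^*(B)$-invariant polynomial functions on $\mathfrak{b}^*$. *)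

(* Defs.v *)
(* MathComp; realType is used only so that R[i] is the field of complex
   numbers. *)
From HB Require Import structures.
From mathcomp Require Import all_boot all_order all_algebra.
From mathcomp Require Import reals complex mpoly ring.

Set Implicit Arguments.
Unset Strict Implicit.
Unset Printing Implicit Defensive.

Import GRing.Theory.
Local Open Scope ring_scope.

Section Group.
Variables (K : fieldType) (n : nat).

(* V is the space of columns 'cV[K]_n and V^* the space of rows 'rV[K]_n. *)
Record grpB := GrpB {
  glB : 'M[K]_n;
  glB_unit : glB \in unitmx;
  vecB : 'cV[K]_n;
  covB : 'rV[K]_n }.

Definition mulB (b c : grpB) : grpB :=
  @GrpB (glB b *m glB c)
        (etrans (unitmx_mul _ _) (introT andP (conj (glB_unit b) (glB_unit c))))
        (vecB b + glB b *m vecB c)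
        (covB b + covB c *m invmx (glB b)).

Definition oneB : grpB := @GrpB 1%:M (unitmx1 K n) 0 0.

Definition invB (b : grpB) : grpB :=
  @GrpB (invmx (glB b)) (etrans (unitmx_inv _) (glB_unit b))
        (- (invmx (glB b) *m vecB b)) (- (covB b *m glB b)).

Lemma grpB_eq (b c : grpB) :
  glB b = glB c -> vecB b = vecB c -> covB b = covB c -> b = c.
Proof.
case: b c => [g gU u v] [h hU u' v'] /= eg eu ev.
by move: hU; rewrite -eg -eu -ev => hU; rewrite (bool_irrelevance gU hU).
Qed.

Lemma invmx_mul (x y : 'M[K]_n) : x \in unitmx -> y \in unitmx ->
  invmx (x *m y) = invmx y *m invmx x.
Proof.
move=> ux uy; have uxy : x *m y \in unitmx by rewrite unitmx_mul ux uy.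
apply: (can_inj (mulKmx uxy)); rewrite mulmxV // !mulmxA.
by rewrite (mulmxK uy) mulmxV.
Qed.

Lemma mulBA : associative mulB.
Proof.
move=> a b c; apply: grpB_eq; rewrite /= ?mulmxA //.
  by rewrite mulmxDr addrA mulmxA.
by rewrite (invmx_mul (glB_unit a)) ?glB_unit // mulmxDl addrA mulmxA.
Qed.

Lemma mul1B : left_id oneB mulB.
Proof. by move=> b; apply: grpB_eq; rewrite /= ?mul1mx ?add0r ?invmx1 ?mulmx1. Qed.

Lemma mulVB : left_inverse oneB invB mulB.
Proof.
move=> b; have ub := glB_unit b; apply: grpB_eq; rewrite /= ?mulVmx ?addNr //.
by rewrite invmxK addNr.
Qed.

Lemma mulBV : right_inverse oneB invB mulB.
Proof.
move=> b; have ub := glB_unit b; apply: grpB_eq; rewrite /= ?mulmxV //.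
  by rewrite mulmxN mulmxA mulmxV // mul1mx subrr.
by rewrite mulNmx mulmxK // subrr.
Qed.

End Group.

Section LieAlgebra.
Variables (K : fieldType) (n : nat).

Definition lieb : Type := ('M[K]_n * 'cV[K]_n * 'rV[K]_n)%type.

Definition brb (X Y : lieb) : lieb :=
  let: (x, u, v) := X in let: (x', u', v') := Y in
  (x *m x' - x' *m x, x *m u' - x' *m u, v *m x' - v' *m x).

(* The differential at the identity of the conjugation by b, obtained by
   letting s tend to 0 in [conjB_curve]. *)
Definition Adb (b : grpB K n) (X : lieb) : lieb :=
  let: (x, a, c) := X in
  let g := glB b in
  (g *m x *m invmx g,
   g *m a - g *m x *m invmx g *m vecB b,
   c *m invmx g + covB b *m g *m x *m invmx g).

Definition dualb : Type := ('M[K]_n * 'rV[K]_n * 'cV[K]_n)%type.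

Definition pairb (l : dualb) (X : lieb) : K :=
  let: (y, w, xi) := l in let: (x, u, v) := X in
  \tr (y *m x) + (w *m u) 0 0 + (v *m xi) 0 0.

(* The element of [dualb] representing the linear form phi, see [pairb_form];
   y is transposed because the pairing on gl(n) is the trace form. *)
Definition dual_of_form (phi : lieb -> K) : dualb :=
  (\matrix_(i, j) phi (delta_mx j i, 0, 0),
   \row_j phi (0, delta_mx j 0, 0),
   \col_i phi (0, 0, delta_mx 0 i)).

Definition coAdb (b : grpB K n) (l : dualb) : dualb :=
  dual_of_form (fun X => pairb l (Adb (invB b) X)).

(* The symmetric algebra S(b) is the polynomial algebra on a basis of b: the
   matrix units, followed by the standard bases of V and V^*. *)
Definition dimb := (n * n + n + n)%N.

Definition coordb (X : lieb) : 'rV[K]_dimb :=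
  let: (x, u, v) := X in row_mx (row_mx (mxvec x) u^T) v.

Definition uncoordb (r : 'rV[K]_dimb) : lieb :=
  (vec_mx (lsubmx (lsubmx r)), (rsubmx (lsubmx r))^T, rsubmx r).

Definition basisb (i : 'I_dimb) : lieb := uncoordb (delta_mx 0 i).

Definition Symb : Type := {mpoly K[dimb]}.

Definition injS (X : lieb) : Symb := \sum_(i < dimb) coordb X 0 i *: 'X_i.

(* The derivation of S(b) extending ad X, see [adS_injS] and [adSM]. *)
Definition adS (X : lieb) (p : Symb) : Symb :=
  \sum_(i < dimb) injS (brb X (basisb i)) * p^`M(i).

(* The polynomial function on b^* defined by an element of S(b); it extends
   X |-> <., X>, see [evS_injS]. *)
Definition evS (p : Symb) (l : dualb) : K := p.@[fun i => pairb l (basisb i)].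

Definition polyfun (f : dualb -> K) : Prop := exists p : Symb, f =1 evS p.

Definition coAd_invariant (f : dualb -> K) : Prop :=
  forall (b : grpB K n) (l : dualb), f (coAdb b l) = f l.

(* The functions on b^* defined by the b-invariants in S(b). *)
Definition Yb (f : dualb -> K) : Prop :=
  exists2 p : Symb, (forall X : lieb, adS X p = 0) & f =1 evS p.

End LieAlgebra.

Section Subalgebra.
Variables (K : fieldType) (T : Type) (m : nat) (F : 'I_m -> T -> K).

Definition in_subalg (f : T -> K) : Prop :=
  exists P : {mpoly K[m]}, forall t, f t = P.@[fun k => F k t].

Definition alg_independent : Prop :=
  forall P : {mpoly K[m]}, (forall t, P.@[fun k => F k t] = 0) -> P = 0.

End Subalgebra.

Section Generators.
Variables (K : fieldType) (n : nat).

(* p_j(x), for 1 <= j <= n. *)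
Definition pcoef (j : nat) (x : 'M[K]_n) : K := - (char_poly x)`_(n - j).

Definition Bmx (k : nat) (x : 'M[K]_n) : 'M[K]_n :=
  x ^+ k - \sum_(1 <= j < k.+1) pcoef j x *: x ^+ (k - j).

Definition Fb (k : nat) (l : dualb K n) : K :=
  let: (y, w, xi) := l in (w *m Bmx k y *m xi) 0 0.

End Generators.

Section Checks.
Variables (K : fieldType) (n : nat).
Implicit Types (b c : grpB K n) (X Y Z : lieb K n) (l : dualb K n).

Lemma conjB_curve b (x : 'M[K]_n) (a : 'cV[K]_n) (c : 'rV[K]_n) (s : K)
    (U : 1%:M + s *: x \in unitmx) :
  let d := mulB (mulB b (GrpB U (s *: a) (s *: c))) (invB b) in
  let g := glB b in
  [/\ glB d = 1%:M + s *: (g *m x *m invmx g),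
      vecB d = s *: (g *m a - g *m x *m invmx g *m vecB b) &
      covB d = s *: (c *m invmx g
               + covB b *m g *m x *m invmx (1%:M + s *: x) *m invmx g)].
Proof.
set t := 1%:M + _ in U *; have ub := glB_unit b; rewrite /=; split.
- rewrite /t mulmxDr mulmx1 mulmxDl mulmxV //.
  by rewrite -scalemxAr -scalemxAl.
- rewrite mulmxN mulmxA {1}/t mulmxDr mulmx1 mulmxDl mulmxV //.
  rewrite mulmxDl mul1mx -!scalemxAr -!scalemxAl scalerBr.
  by rewrite opprD addrACA subrr add0r.
rewrite invmx_mul //.
have E : s *: (x *m invmx t) = 1%:M - invmx t.
  apply: (can_inj (mulmxK U)); rewrite mulmxBl mulVmx // mul1mx.
  by rewrite -scalemxAl mulmxKV // /t addrC addKr.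
rewrite -scalemxAl scalerDr addrAC addrC; congr (_ + _).
rewrite mulNmx -!mulmxA [x *m _]mulmxA scalemxAr scalemxAr scalemxAl E.
by rewrite mulmxBl mul1mx !mulmxBr mulmxV // mulmx1.
Qed.

Lemma linear_deltaE (W : lmodType K) m p (psi : 'M[K]_(m, p) -> W) x :
  linear psi -> psi x = \sum_i \sum_j x i j *: psi (delta_mx i j).
Proof.
move=> psiL.
pose psi' := GRing.isLinear.Build _ _ _ _ psi psiL.
pose f : {linear 'M[K]_(m, p) -> W} := HB.pack psi psi'.
rewrite -[psi]/(f : _ -> _) {1}[x]matrix_sum_delta linear_sum.
apply: eq_bigr => i _; rewrite linear_sum; apply: eq_bigr => j _.
by rewrite linearZ.
Qed.

Lemma scalar_deltaE m p (psi : 'M[K]_(m, p) -> K) (x : 'M[K]_(m, p)) :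
  scalar psi -> psi x = \sum_i \sum_j x i j * psi (delta_mx i j).
Proof. exact: (@linear_deltaE K^o). Qed.

Lemma liebDE (x x' : 'M[K]_n) (u u' : 'cV[K]_n) (v v' : 'rV[K]_n) :
  (x, u, v) + (x', u', v') = (x + x', u + u', v + v') :> lieb K n.
Proof. by []. Qed.

Lemma liebZE r (x : 'M[K]_n) (u : 'cV[K]_n) (v : 'rV[K]_n) :
  r *: (x, u, v) = (r *: x, r *: u, r *: v) :> lieb K n.
Proof. by []. Qed.

Lemma pairb_form (phi : lieb K n -> K) X :
  scalar phi -> pairb (dual_of_form phi) X = phi X.
Proof.
case: X => [[x u] v] phiL.
have phiD Y Z : phi (Y + Z) = phi Y + phi Z.
  by rewrite -[Y]scale1r phiL mul1r scale1r.
have -> : phi (x, u, v) = phi (x, 0, 0) + phi (0, u, 0) + phi (0, 0, v).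
  by rewrite -!phiD !liebDE !(addr0, add0r).
congr (_ + _ + _).
- rewrite (@scalar_deltaE _ _ (fun z => phi (z, 0, 0))); last first.
    move=> r y z; rewrite -phiL; congr phi.
    by rewrite liebZE liebDE !scaler0 !addr0.
  rewrite /mxtrace exchange_big; apply: eq_bigr => i _; rewrite mxE.
  by apply: eq_bigr => j _; rewrite mxE mulrC.
- rewrite (@scalar_deltaE _ _ (fun z => phi (0, z, 0))); last first.
    move=> r y z; rewrite -phiL; congr phi.
    by rewrite liebZE liebDE !scaler0 !addr0.
  rewrite mxE; apply: eq_bigr => i _; by rewrite big_ord1 mxE mulrC.
rewrite (@scalar_deltaE _ _ (fun z => phi (0, 0, z))); last first.
  move=> r y z; rewrite -phiL; congr phi.
  by rewrite liebZE liebDE !scaler0 !addr0.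
by rewrite mxE big_ord1; apply: eq_bigr => i _; rewrite mxE.
Qed.

Lemma pairb_scalar l : scalar (pairb l).
Proof.
case: l => [[y w] xi] r [[x u] v] [[x' u'] v'] /=.
rewrite !mulmxDr !mulmxDl -!scalemxAr -!scalemxAl linearD linearZ /=.
by rewrite !mxE; ring.
Qed.

Lemma Adb_linear b : linear (Adb b).
Proof.
move=> r [[x u] v] [[x' u'] v']; rewrite liebZE liebDE.
apply: (congr2 pair (congr2 pair _ _) _) => /=.
- by rewrite mulmxDr mulmxDl -scalemxAr -scalemxAl.
- rewrite !mulmxDr -!scalemxAr !mulmxDl -!scalemxAl.
  by rewrite scalerBr opprD addrACA.
rewrite !mulmxDr -!scalemxAr !mulmxDl -!scalemxAl.
by rewrite scalerDr addrACA.
Qed.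

Lemma pairb_coAdb b l X : pairb (coAdb b l) X = pairb l (Adb (invB b) X).
Proof.
apply: pairb_form => r Y Z.
by rewrite Adb_linear pairb_scalar.
Qed.

Lemma Adb_mulB b c X : Adb (mulB b c) X = Adb b (Adb c X).
Proof.
have [ub uc] := (glB_unit b, glB_unit c).
case: X => [[x u] v]; apply: (congr2 pair (congr2 pair _ _) _) => /=.
- by rewrite invmx_mul // !mulmxA.
- rewrite invmx_mul // !mulmxDr !mulmxN !mulmxA !mulmxKV //.
  by rewrite opprD addrA addrAC.
rewrite invmx_mul // !(mulmxDl, mulmxDr) !mulmxA !mulmxKV //.
by rewrite -addrA [X in _ + X]addrC addrA.
Qed.

Lemma Adb_brb b X Y : Adb b (brb X Y) = brb (Adb b X) (Adb b Y).
Proof.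
have ub := glB_unit b.
case: X Y => [[x u] v] [[x' u'] v'].
apply: (congr2 pair (congr2 pair _ _) _) => /=.
- by rewrite !(mulmxBl, mulmxBr) !mulmxA !mulmxKV.
- rewrite !(mulmxBl, mulmxBr) !mulmxA !mulmxKV // !opprB.
  by rewrite addrACA [RHS]addrACA [X in _ + X = _]addrC.
rewrite !(mulmxBl, mulmxBr, mulmxDl) !mulmxA !mulmxKV //.
by rewrite opprD mulNmx addrACA.
Qed.

Lemma coordbK : cancel (@coordb K n) (@uncoordb K n).
Proof.
move=> [[x u] v]; rewrite /uncoordb /coordb.
by rewrite !(row_mxKl, row_mxKr) mxvecK trmxK.
Qed.

Lemma uncoordbK : cancel (@uncoordb K n) (@coordb K n).
Proof. by move=> r; rewrite /coordb /= vec_mxK trmxK !hsubmxK. Qed.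

Lemma uncoordb_linear : linear (@uncoordb K n).
Proof. by move=> r x y; rewrite /uncoordb liebZE liebDE -!linearP. Qed.

Lemma coordb_linear : linear (@coordb K n).
Proof.
by move=> r x y; apply: (can_inj uncoordbK); rewrite uncoordb_linear !coordbK.
Qed.

Lemma coordb_basisb (i : 'I_(dimb n)) : coordb (basisb K i) = delta_mx 0 i.
Proof. exact: uncoordbK. Qed.

Lemma evS_injS X l : evS (injS X) l = pairb l X.
Proof.
rewrite /evS /injS raddf_sum /=.
rewrite -[in RHS](coordbK X).
rewrite (@scalar_deltaE _ _ (fun r => pairb l (uncoordb r))).
  by rewrite big_ord1; apply: eq_bigr => i _; rewrite mevalZ mevalXU.
by move=> r x y; rewrite uncoordb_linear pairb_scalar.
Qed.

Lemma brb_linear X : linear (brb X).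
Proof.
case: X => [[x u] v] r [[x' u'] v'] [[x'' u''] v'']; rewrite liebZE liebDE.
apply: (congr2 pair (congr2 pair _ _) _) => /=;
  rewrite ?(mulmxDr, mulmxDl) -?scalemxAr -?scalemxAl scalerBr;
  by rewrite opprD addrACA.
Qed.

Lemma injS_linear : linear (@injS K n).
Proof.
move=> r X Y; rewrite /injS coordb_linear scaler_sumr -big_split.
by apply: eq_bigr => i _; rewrite !mxE scalerDl scalerA.
Qed.

Lemma adS_injS X Y : adS X (injS Y) = injS (brb X Y).
Proof.
rewrite -[in RHS](coordbK Y).
rewrite (@linear_deltaE _ _ _ (fun r => injS (brb X (uncoordb r)))); last first.
  by move=> r x y; rewrite uncoordb_linear brb_linear injS_linear.
rewrite big_ord1; apply: eq_bigr => i _; rewrite {2}/injS raddf_sum /=.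
rewrite (bigD1 i) //= big1 => [|j ji].
  rewrite addr0 mderivZ mderivX mnm1E eqxx.
  rewrite -[X in (X - _)%MM]add0m addmK mpolyX0 scale1r.
  by rewrite -scalerAr mulr1.
by rewrite mderivZ mderivX mnm1E (negPf ji) scale0r scaler0.
Qed.

Lemma adSM X (p q : Symb K n) : adS X (p * q) = adS X p * q + p * adS X q.
Proof.
rewrite /adS mulr_suml mulr_sumr -big_split; apply: eq_bigr => i _ /=.
by rewrite mderivM; ring.
Qed.

End Checks.

(* Main.v *)
(* Conjugating by g, and adding u w - xi v to y, changes the bordered matrix
   [[t - y, xi], [w, 0]] only by left and right factors whose determinants
   multiply to 1; its determinant is - sum_k F_k t^(n-1-k), so the F_k are
   invariant.  On the slice (N, c, e_0), with N the nilpotent shift, F_k takes the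
   value c_k, whence the algebraic independence.  If the vectors B_j(y) xi form a
   basis, then writing l in this basis and using
   y B_j(y) xi = B_(j+1)(y) xi + p_(j+1)(y) xi to subtract xi p from y moves l to
   the point of the slice with c = F(l).  So an invariant f agrees with its
   restriction to the slice evaluated at F on a dense set, hence everywhere.

   The b-invariants in S(b) are compared with the invariant polynomial functions
   one homogeneous component p of degree d at a time.  Let D(t) = det(1 + t x).
   The curve D(t) Ad^*(1 + t x) l is polynomial in t, and for N(t) the value of p
   on it, D N' - d D' N is, up to sign, the value of ad(X_t) p for some X_t in
   gl(n).  If p is b-invariant, this is 0 and N = N(0) D^d, which is invariance
   under 1 + t x; conversely invariance gives N = p(l) D^d, and t = 0 gives
   ad(x) p = 0. *)
Require Import Defs.
From mathcomp Require Import all_boot all_order all_algebra.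
From mathcomp Require Import perm reals complex mpoly ring.

Set Implicit Arguments.
Unset Strict Implicit.
Unset Printing Implicit Defensive.

Import GRing.Theory.
Local Open Scope ring_scope.

(** * Polynomials and curves in characteristic 0 *)

Section Char0.
Variable K : fieldType.
Hypothesis K0 : [pchar K] =i pred0.

Lemma natr_eq0_char0 k : (k%:R == 0 :> K) = (k == 0)%N.
Proof. by move/pcharf0P: K0. Qed.

Lemma natr_inj_char0 : injective (fun k : nat => k%:R : K).
Proof.
move=> i j; wlog le_ij : i j / (i <= j)%N => [hw|] eq_ij.
  by case/orP: (leq_total i j) => /hw ->.
have : (j - i)%:R == 0 :> K by rewrite natrB // eq_ij subrr.
by rewrite natr_eq0_char0 subn_eq0 => le_ji; apply/eqP; rewrite eqn_leq le_ij.
Qed.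

(** In characteristic 0 the first [size p] naturals are distinct elements of [K], which is one root
    too many for a nonzero [p]. *)
Lemma poly_eq0_horner (p : {poly K}) : (forall t, p.[t] = 0) -> p = 0.
Proof.
move=> p0; apply/eqP/negPn/negP => nz_p.
pose s := [seq k%:R : K | k <- iota 0 (size p)].
have us : uniq s by rewrite (map_inj_uniq natr_inj_char0) iota_uniq.
have /(max_poly_roots nz_p)/(_ us) : all (root p) s.
  by apply/allP => t _; apply/rootP.
by rewrite size_map size_iota ltnn.
Qed.

Lemma poly_eq_horner (p q : {poly K}) : (forall t, p.[t] = q.[t]) -> p = q.
Proof.
move=> pq; apply/eqP; rewrite -subr_eq0; apply/eqP/poly_eq0_horner => t.
by rewrite hornerD hornerN pq subrr.
Qed.

(* Compares the orders of vanishing at 0 of the two sides. *)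
Lemma deriv_log_unique (D N : {poly K}) (d : nat) :
  D.[0] != 0 -> D * N^`() = (D^`() * N) *+ d -> N.[0] = 0 -> N = 0.
Proof.
move=> D0 ode N0; apply/eqP/negPn/negP => nzN.
have [k [U]] := multiplicity_XsubC N 0; rewrite subr0 nzN /= => U0 defN.
case: k defN => [|k] defN.
  by case/negP: U0; apply/rootP; rewrite -[RHS]N0 defN mulr1.
have : 'X^k * (D * (U^`() * 'X + U *+ k.+1)) = 'X^k * (D^`() * U * 'X *+ d).
  transitivity (D * N^`()); first by rewrite defN derivM derivXn /= exprS; ring.
  by rewrite ode defN exprS; ring.
move/(mulfI (monic_neq0 (monicXn _ _)))/(congr1 (horner^~ 0)).
rewrite !(hornerM, hornerMn, hornerD, hornerX, mulr0, add0r) mul0rn.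
move/eqP; rewrite mulf_eq0 (negPf D0) -mulr_natr mulf_eq0 natr_eq0_char0 orbF.
by rewrite -rootE (negPf U0).
Qed.

(** [D ^+ d] solves the same linear equation, so [N - N.[0] *: D ^+ d] is a solution vanishing at
    0. *)
Lemma deriv_log_eq (D N : {poly K}) (d : nat) :
  D.[0] = 1 -> D * N^`() = (D^`() * N) *+ d -> N = N.[0] *: D ^+ d.
Proof.
move=> D0 ode; apply/eqP; rewrite -subr_eq0; apply/eqP.
apply: (@deriv_log_unique D _ d); rewrite ?D0 ?oner_eq0 //; last first.
  by rewrite !hornerE ?horner_exp D0 expr1n mulr1 subrr.
rewrite derivB mulrBr ode derivZ deriv_exp.
case: d {ode} => [|d] /=; rewrite ?mulr0n; first by rewrite scaler0 mulr0 subr0.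
by rewrite -!mul_polyC exprS; ring.
Qed.

End Char0.

Section Curves.
Variables (K : fieldType) (m : nat).
Implicit Types (p : {mpoly K[m]}) (q : 'I_m -> {poly K}).

(** Composition with a polynomial curve, kept as a formal polynomial in the parameter so that it can
    be differentiated. *)
Definition mcurve p q : {poly K} := mmap (@polyC K) q p.

Lemma horner_mcurve p q t : (mcurve p q).[t] = p.@[fun i => (q i).[t]].
Proof.
rewrite /mcurve mevalE /mmap horner_sum; apply: eq_bigr => c _.
rewrite hornerM hornerC /mmap1 horner_prod; congr (_ * _).
by apply: eq_bigr => i _; rewrite horner_exp.
Qed.

(** The chain rule: it holds for constants and variables, and is stable under sums and products. *)
Lemma deriv_mcurve p q :
  (mcurve p q)^`() = \sum_i mcurve p^`M(i) q * (q i)^`().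
Proof.
rewrite /mcurve; pose P p := ((mmap (@polyC K) q p)^`() =
  \sum_i mmap (@polyC K) q p^`M(i) * (q i)^`()).
have P0 c : P c%:MP.
  rewrite /P mmapC derivC big1 // => i _.
  by rewrite mderivC mmap0 mul0r.
have PD p1 p2 : P p1 -> P p2 -> P (p1 + p2).
  rewrite /P mmapD derivD => -> ->; rewrite -big_split; apply: eq_bigr => i _ /=.
  by rewrite mderivD mmapD mulrDl.
have PM p1 p2 : P p1 -> P p2 -> P (p1 * p2).
  rewrite /P rmorphM /= derivM => -> ->.
  rewrite mulr_suml mulr_sumr -big_split; apply: eq_bigr => i _ /=.
  by rewrite mderivM mmapD !rmorphM /=; ring.
have PX i : P 'X_i.
  rewrite /P mmapX mmap1U (bigD1 i) //= big1 => [|j ji].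
    by rewrite addr0 mderivX mnm1E eqxx scale1r -[X in (X - _)%MM]add0m addmK mpolyX0 rmorph1 mul1r.
  by rewrite mderivX mnm1E eq_sym (negPf ji) scale0r mmap0 mul0r.
have PE i k : P ('X_i ^+ k) by elim: k => [|k IH]; [exact: (P0 1)|rewrite exprS; exact: PM].
rewrite -/(P p) [p]mpolyE; apply: big_ind => [||c _]; rewrite -?mpolyC0 //.
rewrite -mul_mpolyC; apply: (PM) => //; rewrite mpolyXE_id.
by apply: big_ind => [||i _]; [exact: (P0 1)|exact: PM|exact: PE].
Qed.

Lemma mpoly_euler d p : p \is d.-homog -> \sum_i 'X_i * p^`M(i) = p *+ d.
Proof.
move/dhomogP => hp.
have -> : \sum_i 'X_i * p^`M(i)
    = \sum_(c <- msupp p) p@_c *: \sum_i 'X_i * 'X_[c]^`M(i).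
  transitivity (\sum_i \sum_(c <- msupp p) p@_c *: ('X_i * 'X_[c]^`M(i))).
    apply: eq_bigr => i _; rewrite {1}[p]mpolyE raddf_sum mulr_sumr /=.
    by apply: eq_bigr => c _; rewrite mderivZ scalerAr.
  by rewrite exchange_big; apply: eq_bigr => c _; rewrite scaler_sumr.
rewrite [in RHS](mpolyE p) -sumrMnl; apply: eq_big_seq => c /hp dc.
rewrite scalerMnr -dc /= mdegE; congr (_ *: _); rewrite -sumrMnr.
apply: eq_bigr => i _; rewrite mderivX -scalerAr -mpolyXD addmC.
case: (posnP (c i)) => [->|ci]; first by rewrite scale0r.
rewrite submK; first by rewrite scaler_nat.
by apply/mnm_lepP => j; rewrite mnm1E; case: eqP => // <-.
Qed.

Lemma mcurve_homog_ode d p q (D : {poly K}) (a : 'I_m -> {poly K}) :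
  p \is d.-homog -> (forall i, D * (q i)^`() = D^`() * q i + a i) ->
  D * (mcurve p q)^`() = (D^`() * mcurve p q) *+ d + \sum_i mcurve p^`M(i) q * a i.
Proof.
move=> hp ode; have := congr1 (mmap (@polyC K) q) (mpoly_euler hp).
rewrite raddf_sum raddfMn /= -!/(mcurve _ _) => euler.
rewrite -mulrnAr -euler deriv_mcurve !mulr_sumr -big_split; apply: eq_bigr => i _ /=.
by rewrite rmorphM /= mmapX mmap1U -!/(mcurve _ _) mulrCA ode; ring.
Qed.

Lemma pihomog_ge_msize d p : (msize p <= d)%N -> pihomog mdeg d p = 0.
Proof.
move=> le_d; rewrite pihomogE big_seq_cond big1 // => c /andP[/msize_mdeg_lt lt_c /eqP dc].
by move: lt_c; rewrite /= dc ltnNge le_d.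
Qed.

Lemma meval_homogZ d p (v : 'I_m -> K) s : p \is d.-homog ->
  p.@[fun i => s * v i] = s ^+ d * p.@[v].
Proof.
move/dhomogP => hp; rewrite !mevalE mulr_sumr; apply: eq_big_seq => c /hp <- /=.
rewrite mulrCA; congr (_ * _); rewrite mdegE expr_sum -big_split.
by apply: eq_bigr => i _; rewrite exprMn.
Qed.

(** Induction on the size: the partial derivatives of [p] also vanish everywhere, hence are 0, and
    in characteristic 0 this makes [p] constant. *)
Lemma mpoly_eq0_meval (K0 : [pchar K] =i pred0) p : (forall v, p.@[v] = 0) -> p = 0.
Proof.
have [k] := ubnP (msize p); elim: k p => // k IHk p szp p0.
have dp i : p^`M(i) = 0.
  case: (eqVneq p^`M(i) 0) => // nzd; apply: IHk => [|v].
    have nzp : p != 0 by apply: contraNneq nzd => ->; rewrite raddf0.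
    rewrite -ltnS (leq_trans _ szp) // ltnS -[leqRHS]prednK ?lt0n ?msize_poly_eq0 //.
    rewrite ltnS msizeE; apply/bigmax_leqP_seq => c.
    rewrite mcoeff_msupp mcoeff_deriv => nzc _.
    have: (c + U_(i))%MM \in msupp p.
      by rewrite mcoeff_msupp; apply: contraNneq nzc => ->; rewrite mul0rn.
    move/msize_mdeg_lt; rewrite mdegD mdeg1 addn1 => lt_c.
    by rewrite -ltnS prednK // (leq_trans _ lt_c).
  (* The line through [v] in the [i]-th direction; the derivative of [p] along it at 0 is the [i]-th
     partial derivative at [v]. *)
  pose q j : {poly K} := (v j)%:P + (i == j)%:R *: 'X.
  have N0 : mcurve p q = 0.
    by apply: poly_eq0_horner => // t; rewrite horner_mcurve p0.
  have := congr1 (horner^~ 0) (deriv_mcurve p q).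
  rewrite N0 deriv0 horner0 horner_sum (bigD1 i) //= big1 => [|j ji].
    rewrite addr0 hornerM /q derivD derivC derivZ derivX eqxx scale1r add0r hornerC mulr1.
    rewrite horner_mcurve => ->; apply: meval_eq => j.
    by rewrite !hornerE.
  by rewrite hornerM /q derivD derivC derivZ eq_sym (negPf ji) scale0r addr0 horner0 mulr0.
have pC : p = (p@_0)%:MP.
  apply/mpolyP => c; rewrite mcoeffC; case: (eqVneq c 0%MM) => [->|nz]; first by rewrite mulr1.
  rewrite mulr0; have [i ci] : exists i, (0 < c i)%N.
    apply/existsP; apply: contraR nz => /existsPn nc; apply/eqP/mnmP => i.
    by rewrite mnm0E; have := nc i; rewrite lt0n negbK => /eqP.
  have := mcoeff_deriv i (c - U_(i)) p; rewrite dp mcoeff0 submK; last first.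
    by apply/mnm_lepP => j; rewrite mnm1E; case: eqP => // <-.
  move/esym/eqP; rewrite -mulr_natr mulf_eq0 natr_eq0_char0 // orbF.
  by move/eqP.
by rewrite pC; have := p0 (fun=> 0); rewrite {1}pC mevalC => ->; rewrite mpolyC0.
Qed.

End Curves.

(** * Invariance under the group and under its Lie algebra *)

Section Coadjoint.
Variables (K : fieldType) (n : nat).
Implicit Types (l : dualb K n) (X : lieb K n) (b : grpB K n) (p : Symb K n).

Lemma mxtrace_mul_delta (A : 'M[K]_n) i j : \tr (A *m delta_mx j i) = A i j.
Proof.
rewrite /mxtrace (bigD1 i) //= big1 => [|k ki]; rewrite !mxE (bigD1 j) //=.
  by rewrite big1 ?mxE ?eqxx ?mulr1 ?addr0 // => k kj; rewrite mxE (negPf kj) mulr0.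
rewrite big1 ?mxE ?(negPf ki) ?andbF ?mulr0 ?addr0 // => k' kj.
by rewrite mxE (negPf kj) mulr0.
Qed.

Lemma pairb_inj l l' : pairb l =1 pairb l' -> l = l'.
Proof.
case: l l' => [[y w] xi] [[y' w'] xi'] eq_ll'.
congr (_, _, _).
- apply/matrixP => i j; have := eq_ll' (delta_mx j i, 0, 0).
  by rewrite /= !mxtrace_mul_delta !(mulmx0, mul0mx) !mxE !addr0.
- apply/rowP => j; have := eq_ll' (0, delta_mx j 0, 0).
  by rewrite /= !(mulmx0, mul0mx) linear0 -!colE !mxE !addr0 !add0r.
- apply/colP => j; have := eq_ll' (0, 0, delta_mx 0 j).
  by rewrite /= !(mulmx0, mul0mx) linear0 -!rowE !mxE !add0r.
Qed.

Lemma mx11_trE (a : 'rV[K]_n) (c : 'cV[K]_n) : (a *m c) 0 0 = \tr (c *m a).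
Proof. by rewrite mxtrace_mulC /mxtrace big_ord1. Qed.

(** Both sides have the same pairing with every element of the Lie algebra, by cyclicity of the
    trace. Later computations with the action use this closed form. *)
Lemma coAdbE b (y : 'M[K]_n) w xi :
  let g := glB b in
  coAdb b (y, w, xi) =
  (g *m y *m invmx g + vecB b *m w *m invmx g - g *m xi *m covB b,
   w *m invmx g, g *m xi).
Proof.
move=> g; have ug : g \in unitmx := glB_unit b.
apply: pairb_inj => -[[x u] v]; rewrite pairb_coAdb /= invmxK -/g.
rewrite !mx11_trE !(mulmxBr, mulmxBl, mulmxDr, mulmxDl, mulmxN, mulNmx) !(mxtraceD, raddfN) /=.
rewrite ?opprK !mulmxA.
rewrite !(mulmxK ug) [\tr (y *m _ *m _ *m g)]mxtrace_mulC.
rewrite [\tr (xi *m v *m g)]mxtrace_mulC [\tr (xi *m covB b *m _ *m g)]mxtrace_mulC.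
rewrite [\tr (u *m w *m _)]mxtrace_mulC.
rewrite -[vecB b *m w *m _ *m x]mulmxA [\tr (vecB b *m w *m _)]mxtrace_mulC.
by rewrite !mulmxA; ring.
Qed.

(** The infinitesimal coadjoint action of [X] on [l]. *)
Definition adstb X l : dualb K n :=
  let: (x, u, v) := X in let: (y, w, xi) := l in
  (x *m y - y *m x + u *m w - xi *m v, - (w *m x), x *m xi).

Lemma pairb_adstb X l Y : pairb (adstb X l) Y = - pairb l (brb X Y).
Proof.
case: X l Y => [[x u] v] [[y w] xi] [[x' u'] v'] /=.
rewrite !mx11_trE !(mulmxBr, mulmxBl, mulmxDr, mulmxDl, mulmxN, mulNmx) !(mxtraceD, raddfN) /=.
rewrite !mulmxA.
rewrite [\tr (y *m x' *m x)]mxtrace_mulC [\tr (u' *m w *m x)]mxtrace_mulC.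
rewrite [\tr (u *m w *m x')]mxtrace_mulC [\tr (xi *m v' *m x)]mxtrace_mulC.
by rewrite !mulmxA; ring.
Qed.

Lemma coAdbZ b s l : coAdb b (s *: l) = s *: coAdb b l.
Proof.
have pairZ r k X : pairb (r *: k) X = r * pairb k X.
  case: k X => [[y w] xi] [[x u] v] /=.
  by rewrite !(=^~ scalemxAl, =^~ scalemxAr) linearZ !mxE /= !mulrDr.
by apply: pairb_inj => X; rewrite pairb_coAdb !pairZ pairb_coAdb.
Qed.

(** The coordinates on the dual take arbitrary values, so that an element of the symmetric algebra
    is determined by its function. *)
Lemma pairb_basisb_surj (v : 'I_(dimb n) -> K) :
  exists l, forall i, pairb l (basisb K i) = v i.
Proof.
exists (dual_of_form (fun X => \sum_i coordb X 0 i * v i)) => i.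
rewrite pairb_form => [|r X Y]; last first.
  rewrite coordb_linear mulr_sumr -big_split; apply: eq_bigr => j _ /=.
  by rewrite !mxE mulrDl mulrA.
rewrite coordb_basisb (bigD1 i) //= big1 => [|j ji].
  by rewrite mxE !eqxx mul1r addr0.
by rewrite mxE (negPf ji) andbF mul0r.
Qed.

Lemma evS_homogZ d p s l : p \is d.-homog -> evS p (s *: l) = s ^+ d * evS p l.
Proof.
move=> hp; rewrite /evS -meval_homogZ //; apply: meval_eq => i.
case: l (basisb K i) => [[y w] xi] [[x u] v] /=.
by rewrite !(=^~ scalemxAl, =^~ scalemxAr) linearZ !mxE /= !mulrDr.
Qed.

Lemma evS_sum (I : Type) (r : seq I) (F : I -> Symb K n) l :
  evS (\sum_(i <- r) F i) l = \sum_(i <- r) evS (F i) l.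
Proof. by rewrite /evS raddf_sum. Qed.

Lemma evS_adS X p l :
  evS (adS X p) l =
  \sum_i pairb l (brb X (basisb K i)) * evS p^`M(i) l.
Proof.
rewrite /adS evS_sum; apply: eq_bigr => i _.
by rewrite -evS_injS /evS rmorphM.
Qed.

Lemma adS_sum X (I : Type) (r : seq I) (F : I -> Symb K n) :
  adS X (\sum_(i <- r) F i) = \sum_(i <- r) adS X (F i).
Proof.
rewrite /adS exchange_big; apply: eq_bigr => i _ /=.
by rewrite raddf_sum mulr_sumr.
Qed.

(** Each term of the derivation removes one variable and inserts a linear form. *)
Lemma adS_homog d X p : p \is d.-homog -> adS X p \is d.-homog.
Proof.
move/dhomogP => hp; apply: rpred_sum => i _; rewrite {1}[p]mpolyE raddf_sum mulr_sumr /=.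
rewrite big_seq; apply: rpred_sum => c /hp dc; rewrite mderivZ -scalerAr; apply: rpredZ.
rewrite mderivX -scalerAr; case: (posnP (c i)) => [->|ci]; first by rewrite scale0r rpred0.
apply: rpredZ; rewrite /injS mulr_suml; apply: rpred_sum => j _.
rewrite -scalerAl; apply: rpredZ; rewrite -mpolyXD dhomogX /= mdegD mdeg1 -dc /=.
have /submK/(congr1 mdeg) : (U_(i) <= c)%MM.
  by apply/mnm_lepP => k; rewrite mnm1E; case: eqP => // <-.
by rewrite mdegD mdeg1 addnC => /eqP.
Qed.

Lemma adS_pihomog X p d : adS X p = 0 -> adS X (pihomog mdeg d p) = 0.
Proof.
move=> Xp; have := congr1 (pihomog mdeg d) (congr1 (adS X) (pihomog_partitionE (leqnn (msize p)))).
rewrite Xp raddf0 adS_sum raddf_sum /=.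
have adS_d e : pihomog mdeg d (adS X (pihomog mdeg e p)) =
    if e == d then adS X (pihomog mdeg d p) else 0.
  have he := adS_homog X (pihomogP mdeg e p).
  case: eqP he => [->|/eqP ne] he; first exact: pihomog_dE he.
  exact: (pihomog_ne0 ne he).
under eq_bigr do rewrite adS_d.
case: (ltnP d (msize p)) => [lt_d|le_d].
  rewrite (bigD1 (Ordinal lt_d)) //= eqxx big1 ?addr0 // => e.
  by rewrite -val_eqE /= => /negPf ->.
by move=> _; rewrite pihomog_ge_msize // /adS big1 // => i _; rewrite raddf0 mulr0.
Qed.

(** Separates gl(n) from the abelian ideal, since the two are treated with different curves. *)
Lemma adS_split x u v p : adS (x, u, v) p = adS (x, 0, 0) p + adS (0, u, v) p.
Proof.
rewrite -big_split; apply: eq_bigr => i _ /=; rewrite -mulrDl; congr (_ * _).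
case: (basisb K i) => [[x' u'] v']; rewrite -[X in _ = X + _]scale1r -injS_linear scale1r.
congr injS; rewrite /brb liebDE !(mulmx0, mul0mx, subr0, sub0r, addr0, oppr0).
by congr (_, _, _); rewrite ?add0r // addrC.
Qed.

End Coadjoint.

(** * Polynomial curves of matrices and along coadjoint orbits *)

Section MatrixCurves.
Variable K : fieldType.
Local Notation "A ^C" := (map_mx (@polyC K) A) (at level 1, format "A ^C").

Lemma deriv_mulmx m p q (A : 'M[{poly K}]_(m, p)) (B : 'M_(p, q)) :
  map_mx (@deriv K) (A *m B) = map_mx (@deriv K) A *m B + A *m map_mx (@deriv K) B.
Proof.
apply/matrixP => i j; rewrite !mxE raddf_sum -big_split; apply: eq_bigr => k _ /=.
by rewrite !mxE derivM.
Qed.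

Lemma deriv_map_polyC m p (A : 'M[K]_(m, p)) : map_mx (@deriv K) A^C = 0.
Proof. by apply/matrixP => i j; rewrite !mxE derivC. Qed.

Lemma deriv_scalemx m p (c : {poly K}) (A : 'M_(m, p)) :
  map_mx (@deriv K) (c *: A) = c^`() *: A + c *: map_mx (@deriv K) A.
Proof. by apply/matrixP => i j; rewrite !mxE derivM. Qed.

Lemma horner_map_polyC m p (A : 'M[K]_(m, p)) t : map_mx (horner_eval t) A^C = A.
Proof. by apply/matrixP => i j; rewrite !mxE /horner_eval hornerC. Qed.

(** The derivative of the inverse without denominators: differentiate [A *m \adj A] and multiply by
    [\adj A] on the left. *)
Lemma deriv_adjugate n (A : 'M[{poly K}]_n) (A' := map_mx (@deriv K) A) :
  \det A *: map_mx (@deriv K) (\adj A) =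
  (\det A)^`() *: \adj A - \adj A *m A' *m \adj A.
Proof.
have : map_mx (@deriv K) (A *m \adj A) = (\det A)^`()%:M.
  by rewrite mul_mx_adj; apply/matrixP => i j; rewrite !mxE raddfMn.
rewrite deriv_mulmx -/A' => /(congr1 (mulmx (\adj A))).
rewrite mulmxDr !mulmxA mul_adj_mx mul_scalar_mx mul_mx_scalar => <-.
by rewrite addrC addKr.
Qed.

Variable n : nat.

Definition curveb (Y : 'M[{poly K}]_n) (W : 'rV_n) (Z : 'cV_n) (t : K) : dualb K n :=
  (map_mx (horner_eval t) Y, map_mx (horner_eval t) W, map_mx (horner_eval t) Z).

Definition ppairb (Y : 'M[{poly K}]_n) (W : 'rV_n) (Z : 'cV_n) (X : lieb K n) : {poly K} :=
  let: (x, u, v) := X in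
  \tr (Y *m x^C) + (W *m u^C) 0 0 + (v^C *m Z) 0 0.

Lemma horner_ppairb Y W Z X t : (ppairb Y W Z X).[t] = pairb (curveb Y W Z t) X.
Proof.
case: X => [[x u] v]; rewrite /ppairb /curveb /= !hornerD.
rewrite -{2}[x](horner_map_polyC x t) -{2}[u](horner_map_polyC u t).
rewrite -{2}[v](horner_map_polyC v t) -!map_mxM /= (trace_map_mx (horner_eval t)).
by rewrite [(map_mx _ (W *m _)) _ _]mxE [(map_mx _ (_ *m Z)) _ _]mxE.
Qed.

Lemma deriv_mxtrace (A : 'M[{poly K}]_n) : (\tr A)^`() = \tr (map_mx (@deriv K) A).
Proof. by rewrite /mxtrace raddf_sum; apply: eq_bigr => i _; rewrite mxE. Qed.

Lemma deriv_ppairb Y W Z X :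
  (ppairb Y W Z X)^`() =
  ppairb (map_mx (@deriv K) Y) (map_mx (@deriv K) W) (map_mx (@deriv K) Z) X.
Proof.
case: X => [[x u] v]; rewrite /ppairb !derivD deriv_mxtrace deriv_mulmx.
rewrite deriv_map_polyC mulmx0 addr0; congr (_ + _ + _).
  have -> : ((W *m u^C) 0 0)^`() = (map_mx (@deriv K) (W *m u^C)) 0 0 by rewrite [RHS]mxE.
  by rewrite deriv_mulmx deriv_map_polyC mulmx0 addr0.
have -> : ((v^C *m Z) 0 0)^`() = (map_mx (@deriv K) (v^C *m Z)) 0 0 by rewrite [RHS]mxE.
by rewrite deriv_mulmx deriv_map_polyC mul0mx add0r.
Qed.

Lemma ppairb_lin D Y W Z Y' W' Z' X :
  ppairb (D *: Y + Y') (D *: W + W') (D *: Z + Z') X =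
  D * ppairb Y W Z X + ppairb Y' W' Z' X.
Proof.
case: X => [[x u] v]; rewrite /ppairb !(mulmxDr, mulmxDl) !(=^~ scalemxAl, =^~ scalemxAr).
have E (A B : 'M[{poly K}]_1) : (D *: A + B) 0 0 = D * A 0 0 + B 0 0 by rewrite !mxE.
by rewrite linearD linearZ /= !E; ring.
Qed.

(** The three hypotheses say that the curve [l] satisfies D l' = D' l + ad^*(X, U, V) l. Every
    coordinate then fits [mcurve_homog_ode], and [pairb_adstb] turns the error term into minus the
    derivation applied to [p]. *)
Lemma coad_curve_ode d (p : Symb K n) Y W Z D
    (X : 'M[{poly K}]_n) (U : 'cV_n) (V : 'rV_n) :
  D *: map_mx (@deriv K) Y = D^`() *: Y + (X *m Y - Y *m X + U *m W - Z *m V) ->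
  D *: map_mx (@deriv K) W = D^`() *: W - W *m X ->
  D *: map_mx (@deriv K) Z = D^`() *: Z + X *m Z ->
  p \is d.-homog ->
  exists N S : {poly K},
    [/\ D * N^`() = (D^`() * N) *+ d + S,
        forall t, N.[t] = evS p (curveb Y W Z t) &
        forall t, S.[t] = - evS (adS (map_mx (horner_eval t) X,
          map_mx (horner_eval t) U, map_mx (horner_eval t) V) p) (curveb Y W Z t)].
Proof.
move=> eY eW eZ hp.
pose q i := ppairb Y W Z (basisb K i).
pose a i := ppairb (X *m Y - Y *m X + U *m W - Z *m V) (- (W *m X)) (X *m Z) (basisb K i).
exists (mcurve p q), (\sum_i mcurve p^`M(i) q * a i); split=> [|t|t].
- apply: mcurve_homog_ode => // i; rewrite deriv_ppairb -[LHS]addr0.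
  (* A zero summand gives the left side the shape required by [ppairb_lin]. *)
  have {1}<- : ppairb 0 0 0 (basisb K i) = 0.
    by case: (basisb K i) => [[? ?] ?]; rewrite /ppairb !(mul0mx, mulmx0) linear0 !mxE !addr0.
  by rewrite -ppairb_lin eY eW eZ !addr0 ppairb_lin.
- by rewrite horner_mcurve; apply: meval_eq => i; rewrite horner_ppairb.
rewrite evS_adS horner_sum -sumrN; apply: eq_bigr => i _.
rewrite hornerM horner_ppairb -[RHS]mulNr -pairb_adstb mulrC; congr (_ * _).
  congr pairb; rewrite /curveb /adstb.
  by rewrite !(map_mxM, raddfB, raddfN, raddfD) /= ?map_mxM.
by rewrite horner_mcurve; apply: meval_eq => j; rewrite horner_ppairb.
Qed.

Definition gl_curve (x : 'M[K]_n) : 'M[{poly K}]_n := 1%:M + 'X *: x^C.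

Lemma horner_gl_curve x t : map_mx (horner_eval t) (gl_curve x) = 1%:M + t *: x.
Proof.
by apply/matrixP => i j; rewrite !mxE /horner_eval !hornerE hornerMn hornerC.
Qed.

Lemma deriv_gl_curve x : map_mx (@deriv K) (gl_curve x) = x^C.
Proof.
by apply/matrixP => i j; rewrite !mxE derivD derivM derivX derivC derivMn derivC; ring.
Qed.

(* The curve is [D t *: coAdb (1 + t x) l], made polynomial by the factor D. *)
Lemma adS_gl_ode d (p : Symb K n) (x : 'M[K]_n) l (D := \det (gl_curve x)) :
  p \is d.-homog ->
  exists N S : {poly K},
    [/\ D * N^`() = (D^`() * N) *+ d + S,
        forall (t : K) (ut : 1%:M + t *: x \in unitmx),
          N.[t] = D.[t] ^+ d * evS p (coAdb (GrpB ut 0 0) l),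
        forall t, exists x' l', S.[t] = - evS (adS (x', 0, 0) p) l' &
        S.[0] = - evS (adS (x, 0, 0) p) l].
Proof.
case: l => [[y w] xi] hp; set g := gl_curve x in D *; pose h := \adj g.
have dh : D *: map_mx (@deriv K) h = D^`() *: h - h *m x^C *m h.
  by rewrite /h deriv_adjugate deriv_gl_curve.
have hg : h *m g = D%:M := mul_adj_mx g.
have gh : g *m h = D%:M := mul_mx_adj g.
(* The logarithmic derivative of [g] is x g^(-1), and [h] is D g^(-1), so the field along the curve,
   scaled by [D], is x h. *)
have [|||N [S [ode N_t S_t]]] := @coad_curve_ode d p
  (g *m y^C *m h) (w^C *m h) (D *: (g *m xi^C)) D (x^C *m h) 0 0 _ _ _ hp.
- rewrite mul0mx mulmx0 addr0 subr0 !deriv_mulmx deriv_gl_curve deriv_map_polyC.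
  rewrite mulmx0 addr0 scalerDr (scalemxAr D (g *m _)) dh mulmxBr.
  have -> : x^C *m h *m (g *m y^C *m h) = D *: (x^C *m y^C *m h).
    by rewrite !mulmxA -[x^C *m h *m g]mulmxA hg mul_mx_scalar -!scalemxAl.
  by rewrite -scalemxAr !mulmxA addrCA.
- rewrite deriv_mulmx deriv_map_polyC mul0mx add0r scalemxAr dh.
  by rewrite mulmxBr -scalemxAr !mulmxA.
- rewrite deriv_scalemx deriv_mulmx deriv_gl_curve deriv_map_polyC mulmx0 addr0.
  rewrite scalerDr; congr (_ + _); first by rewrite !scalerA mulrC.
  rewrite -scalemxAr mulmxA -[x^C *m h *m g]mulmxA hg mul_mx_scalar.
  by rewrite -scalemxAl.
have D_t t : D.[t] = \det (1%:M + t *: x).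
  by rewrite -horner_gl_curve det_map_mx.
have h_t t : map_mx (horner_eval t) h = \adj (1%:M + t *: x).
  by rewrite /h map_mx_adj horner_gl_curve.
have curve_t t : curveb (g *m y^C *m h) (w^C *m h) (D *: (g *m xi^C)) t =
    ((1%:M + t *: x) *m y *m \adj (1%:M + t *: x), w *m \adj (1%:M + t *: x),
     \det (1%:M + t *: x) *: ((1%:M + t *: x) *m xi)).
  rewrite /curveb map_mxZ !map_mxM !horner_map_polyC h_t horner_gl_curve.
  by rewrite -D_t.
exists N, S; split => // [t ut|t|].
- rewrite N_t -evS_homogZ // D_t curve_t; congr evS; rewrite coAdbE /=.
  set gt := 1%:M + t *: x in ut *.
  have -> : \adj gt = \det gt *: invmx gt.
    by apply: (can_inj (mulmxK ut)); rewrite mul_adj_mx -scalemxAl mulVmx // scalemx1.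
  by rewrite !(mul0mx, mulmx0) addr0 subr0 -!scalemxAr.
- rewrite S_t !raddf0.
  by exists (map_mx (horner_eval t) (x^C *m h)),
    (curveb (g *m y^C *m h) (w^C *m h) (D *: (g *m xi^C)) t).
(* At t = 0 the adjugate is that of the identity, so the field is [x] and the curve passes through
   [l]. *)
rewrite S_t !raddf0 curve_t map_mxM horner_map_polyC h_t scale0r addr0 adj1 det1.
by rewrite !(mulmx1, mul1mx) scale1r.
Qed.

End MatrixCurves.

(** * Equivalence of Lie algebra invariance and group invariance *)

Section Invariance.
Variables (K : fieldType) (n : nat).
Hypothesis K0 : [pchar K] =i pred0.
Implicit Types (l : dualb K n) (X : lieb K n) (b : grpB K n) (p : Symb K n).

(** The abelian ideal fixes [w] and [xi] and moves [y] along a line, so here the factor D is 1. *)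
Lemma adS_unipotent_ode d p (u : 'cV[K]_n) (v : 'rV[K]_n) y w xi : p \is d.-homog ->
  exists N S : {poly K},
    [/\ N^`() = S,
        forall t, N.[t] = evS p (y + t *: (u *m w - xi *m v), w, xi) &
        forall t, S.[t] =
          - evS (adS (0, u, v) p) (y + t *: (u *m w - xi *m v), w, xi)].
Proof.
move=> hp; pose c := @polyC K; pose z := u *m w - xi *m v.
have [|||N [S [ode N_t S_t]]] := @coad_curve_ode _ _ d p
  (map_mx c y + 'X *: map_mx c z) (map_mx c w) (map_mx c xi) 1 0 (map_mx c u) (map_mx c v) _ _ _ hp.
- rewrite derivC scale1r scale0r add0r mul0mx mulmx0 subr0 add0r -!map_mxM -map_mxB.
  apply/matrixP => i j; rewrite !mxE derivD derivM derivX !derivC.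
  by rewrite mul1r mulr0 addr0 add0r.
- by rewrite deriv_map_polyC derivC scale0r scaler0 mulmx0 subr0.
- by rewrite deriv_map_polyC derivC scale0r scaler0 mul0mx addr0.
have curve_t t : curveb (map_mx c y + 'X *: map_mx c z) (map_mx c w) (map_mx c xi) t =
    (y + t *: z, w, xi).
  rewrite /curveb raddfD /= map_mxZ !horner_map_polyC.
  by rewrite /= /horner_eval hornerX.
exists N, S; split=> [|t|t].
- by rewrite -[LHS]mul1r ode derivC mul0r mul0rn add0r.
- by rewrite N_t curve_t.
by rewrite S_t curve_t raddf0 !horner_map_polyC.
Qed.

Lemma mpoly_eq0_evS p : (forall l, evS p l = 0) -> p = 0.
Proof.
move=> p0; apply: mpoly_eq0_meval => // v; have [l lv] := pairb_basisb_surj v.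
by rewrite -(p0 l); apply: meval_eq => i; rewrite lv.
Qed.

Lemma poly_deriv0_const (P : {poly K}) s t : P^`() = 0 -> P.[s] = P.[t].
Proof.
move=> P0; rewrite (@deriv_log_eq _ K0 1 P 0) ?hornerC //; last by rewrite P0 mulr0 mulr0n.
by rewrite expr0 alg_polyC !hornerC.
Qed.

(** The element (g, u, v) is the product (1, u, v)(g, 0, 0). The second factor is reached at t = 1
    on the curve 1 + t (g - 1), which may leave GL(n) in between without harm since only polynomial
    identities are used; the first is reached along a line. *)
Lemma coAd_invariant_homog d p :
  p \is d.-homog -> (forall X, adS X p = 0) -> coAd_invariant (evS p).
Proof.
move=> hp Xp b [[y w] xi].
have evS0 l' : evS (0 : Symb K n) l' = 0 by rewrite /evS meval0.
have ub := glB_unit b; pose g := glB b.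
have ug1 : 1%:M + 1 *: (g - 1%:M) \in unitmx by rewrite scale1r addrC subrK.
have GL_inv : evS p (coAdb (GrpB ub 0 0) (y, w, xi)) = evS p (y, w, xi).
  have [N [S [ode N_t S_t _]]] := adS_gl_ode (g - 1%:M) (y, w, xi) hp.
  have S0 : S = 0.
    by apply: (poly_eq0_horner K0) => t; have [x' [l' ->]] := S_t t; rewrite Xp evS0 oppr0.
  have D_t t : (\det (gl_curve (g - 1%:M))).[t] = \det (1%:M + t *: (g - 1%:M)).
    by rewrite -horner_gl_curve det_map_mx.
  have D0 : (\det (gl_curve (g - 1%:M))).[0] = 1 by rewrite D_t scale0r addr0 det1.
  rewrite S0 addr0 in ode.
  have u01 : 1%:M + 0 *: (g - 1%:M) \in unitmx by rewrite scale0r addr0 unitmx1.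
  have eqN := congr1 (horner^~ 1) (deriv_log_eq K0 D0 ode).
  rewrite hornerZ horner_exp (N_t 1 ug1) (N_t 0 u01) D0 expr1n mul1r mulrC in eqN.
  (* At t = 1 the determinant is that of [g], so the factor D^d can be cancelled. *)
  have nzD : (\det (gl_curve (g - 1%:M))).[1] ^+ d != 0.
    by rewrite expf_neq0 // D_t -unitfE.
  move/(mulIf nzD): eqN; rewrite !coAdbE /= !(mul0mx, mulmx0).
  rewrite !addr0 !subr0 scale0r addr0 !scale1r invmx1 !(mul1mx, mulmx1).
  by rewrite [1%:M + _]addrC subrK.
rewrite -GL_inv !coAdbE /= !(mul0mx, mulmx0) !addr0 subr0 -/g.
have [N [S [ode N_t S_t]]] := adS_unipotent_ode (vecB b) (covB b) (g *m y *m invmx g)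
  (w *m invmx g) (g *m xi) hp.
have : N.[1] = N.[0].
  apply: poly_deriv0_const; rewrite ode; apply: (poly_eq0_horner K0) => t.
  by rewrite S_t Xp evS0 oppr0.
by rewrite !N_t scale1r scale0r addr0 mulmxA addrA.
Qed.

(** Along the line of the abelian ideal N is constant, and along the curve 1 + t x it is a multiple
    of D^d; either way the error term [S] vanishes, in particular at 0. *)
Lemma adS_eq0_homog d p :
  p \is d.-homog -> coAd_invariant (evS p) -> forall X, adS X p = 0.
Proof.
move=> hp inv_p [[x u] v]; rewrite adS_split [X in X + _](_ : _ = 0) ?add0r.
  apply: mpoly_eq0_evS => -[[y w] xi].
  have [N [S [ode N_t S_t]]] := adS_unipotent_ode u v y w xi hp.
  apply: oppr_inj; have -> : (y, w, xi) = (y + 0 *: (u *m w - xi *m v), w, xi).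
    by rewrite scale0r addr0.
  rewrite -S_t oppr0.
  suff -> : S = 0 by rewrite horner0.
  rewrite -ode; suff -> : N = (evS p (y, w, xi))%:P by rewrite derivC.
  apply: (poly_eq_horner K0) => t; rewrite N_t hornerC.
  rewrite -[RHS](inv_p (GrpB (unitmx1 K n) (t *: u) (t *: v))) coAdbE /=.
  by rewrite invmx1 !(mul1mx, mulmx1) -scalemxAl -scalemxAr -addrA scalerBr.
apply: mpoly_eq0_evS => l.
have [N [S [ode N_t _ S_0]]] := adS_gl_ode x l hp.
set D := \det _ in ode N_t; apply: oppr_inj; rewrite -S_0 oppr0.
suff -> : S = 0 by rewrite horner0.
have D_t t : D.[t] = \det (1%:M + t *: x) by rewrite -horner_gl_curve det_map_mx.
have nzD : D != 0.
  by apply: contra_eq_neq (D_t 0) => ->; rewrite scale0r addr0 det1 horner0 eq_sym oner_neq0.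
have NE : N = evS p l *: D ^+ d.
  (* The extra factor [D] makes both sides vanish at the values of t for which 1 + t x is singular,
     where invariance says nothing. *)
  apply: (mulIf nzD); apply: (poly_eq_horner K0) => t; rewrite !hornerM hornerZ horner_exp.
  have [ut|] := boolP (1%:M + t *: x \in unitmx).
    by rewrite (N_t t ut) inv_p [evS p l * _]mulrC.
  by rewrite unitmxE unitfE negbK -D_t => /eqP ->; rewrite !mulr0.
apply: (addrI ((D^`() * N) *+ d)); rewrite -ode addr0 NE derivZ deriv_exp.
case: (d) => [|e] /=; first by rewrite !mulr0n scaler0 mulr0.
by rewrite -!mul_polyC exprS; ring.
Qed.

(** The action commutes with scaling, and the components of [p] at [l] are the coefficients of p(s
    l) as a polynomial in s. *)
Lemma coAd_invariant_pihomog p d :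
  coAd_invariant (evS p) -> coAd_invariant (evS (pihomog mdeg d p)).
Proof.
move=> inv_p b l.
pose P l' := \poly_(e < msize p) evS (pihomog mdeg e p) l'.
have P_s l' s : (P l').[s] = evS p (s *: l').
  rewrite horner_poly [in RHS](pihomog_partitionE (leqnn (msize p))) evS_sum.
  by apply: eq_bigr => e _; rewrite mulrC -evS_homogZ // pihomogP.
have eq_P : P (coAdb b l) = P l.
  by apply: (poly_eq_horner K0) => s; rewrite !P_s -coAdbZ inv_p.
have [lt_d|le_d] := ltnP d (msize p).
  by have := congr1 (coefp d) eq_P; rewrite /= !coef_poly lt_d.
by rewrite pihomog_ge_msize // /evS !meval0.
Qed.

Lemma Yb_coAd_invariant (f : dualb K n -> K) :
  Yb f <-> polyfun f /\ coAd_invariant f.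
Proof.
split=> [[p Xp fE]|[[p fE] inv_f]].
  split; first by exists p.
  move=> b l; rewrite !fE (pihomog_partitionE (leqnn (msize p))) !evS_sum.
  apply: eq_bigr => d _; apply: (@coAd_invariant_homog d) => [|X]; first exact: pihomogP.
  exact: adS_pihomog.
exists p => // X; rewrite (pihomog_partitionE (leqnn (msize p))) adS_sum big1 // => d _.
apply: (@adS_eq0_homog d); first exact: pihomogP.
by apply: coAd_invariant_pihomog => b l; rewrite -!fE.
Qed.

End Invariance.

(** * Polynomial functions on the dual *)

Section PolynomialFunctions.
Variables (K : fieldType) (n : nat).
Implicit Types (f g : dualb K n -> K).

Lemma polyfun_ext f g : f =1 g -> polyfun g -> polyfun f.
Proof. by move=> fg [p gp]; exists p => l; rewrite fg. Qed.

Lemma polyfun_const c : polyfun (fun _ : dualb K n => c).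
Proof. by exists c%:MP => l; rewrite /evS mevalC. Qed.

Lemma polyfunD f g : polyfun f -> polyfun g -> polyfun (fun l => f l + g l).
Proof. by move=> [p fp] [q gq]; exists (p + q) => l; rewrite fp gq /evS mevalD. Qed.

Lemma polyfunM f g : polyfun f -> polyfun g -> polyfun (fun l => f l * g l).
Proof. by move=> [p fp] [q gq]; exists (p * q) => l; rewrite fp gq /evS mevalM. Qed.

Lemma polyfunN f : polyfun f -> polyfun (fun l => - f l).
Proof. by move=> [p fp]; exists (- p) => l; rewrite fp /evS mevalN. Qed.

Lemma polyfun_sum (I : Type) (r : seq I) (P : pred I) (F : I -> dualb K n -> K) :
  (forall i, P i -> polyfun (F i)) -> polyfun (fun l => \sum_(i <- r | P i) F i l).
Proof.
move=> pF; elim: r => [|i r IHr].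
  by apply: polyfun_ext (polyfun_const 0) => l; rewrite big_nil.
case Pi: (P i); last by apply: polyfun_ext IHr => l; rewrite big_cons Pi.
by apply: polyfun_ext (polyfunD (pF i Pi) IHr) => l; rewrite big_cons Pi.
Qed.

Lemma polyfun_prod (I : Type) (r : seq I) (F : I -> dualb K n -> K) :
  (forall i, polyfun (F i)) -> polyfun (fun l => \prod_(i <- r) F i l).
Proof.
move=> pF; elim: r => [|i r IHr].
  by apply: polyfun_ext (polyfun_const 1) => l; rewrite big_nil.
by apply: polyfun_ext (polyfunM (pF i) IHr) => l; rewrite big_cons.
Qed.

Lemma polyfunX f k : polyfun f -> polyfun (fun l => f l ^+ k).
Proof.
move=> pf; elim: k => [|k IHk]; first exact: polyfun_const.
by apply: polyfun_ext (polyfunM pf IHk) => l; rewrite exprS.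
Qed.

Lemma polyfun_pairb X : polyfun (fun l : dualb K n => pairb l X).
Proof. by exists (injS X) => l; rewrite evS_injS. Qed.

Lemma polyfun_in_subalg m (F : 'I_m -> dualb K n -> K) f :
  (forall k, polyfun (F k)) -> in_subalg F f -> polyfun f.
Proof.
move=> pF [P fP]; apply: polyfun_ext fP _; rewrite /meval /mmap.
apply: polyfun_sum => c _; apply: polyfunM; first exact: polyfun_const.
by apply: polyfun_prod => i; apply: polyfunX.
Qed.

(** The density argument: the product of the two polynomials vanishes everywhere, and the polynomial
    ring is a domain. *)
Lemma polyfun_mul_eq0 (K0 : [pchar K] =i pred0) f g l0 :
  polyfun f -> polyfun g -> (forall l, g l != 0 -> f l = 0) -> g l0 != 0 ->
  forall l, f l = 0.
Proof.
move=> [p fp] [q gq] fg0 nz_g l; rewrite fp.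
have /eqP : p * q = 0.
  apply: (mpoly_eq0_evS K0) => l'; rewrite /evS mevalM -[p.@[_]]/(evS p l') -[q.@[_]]/(evS q l').
  rewrite -fp -gq; have [->|/fg0 ->] := eqVneq (g l') 0; first by rewrite mulr0.
  by rewrite mul0r.
rewrite mulf_eq0 => /orP[/eqP->|/eqP q0]; first by rewrite /evS meval0.
by case/eqP: nz_g; rewrite gq q0 /evS meval0.
Qed.

Definition mxpolyfun m p (A : dualb K n -> 'M[K]_(m, p)) :=
  forall i j, polyfun (fun l => A l i j).

Lemma mxpolyfunM m p q (A : dualb K n -> 'M_(m, p)) (B : dualb K n -> 'M_(p, q)) :
  mxpolyfun A -> mxpolyfun B -> mxpolyfun (fun l => A l *m B l).
Proof.
move=> pA pB i j; apply: (@polyfun_ext _ (fun l => \sum_k A l i k * B l k j)) => [l|].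
  by rewrite mxE.
by apply: polyfun_sum => k _; apply: polyfunM.
Qed.

Lemma mxpolyfunD m p (A B : dualb K n -> 'M_(m, p)) :
  mxpolyfun A -> mxpolyfun B -> mxpolyfun (fun l => A l + B l).
Proof. by move=> pA pB i j; apply: polyfun_ext (polyfunD (pA i j) (pB i j)) => l; rewrite mxE. Qed.

Lemma mxpolyfunZ m p c (A : dualb K n -> 'M_(m, p)) :
  polyfun c -> mxpolyfun A -> mxpolyfun (fun l => c l *: A l).
Proof. by move=> pc pA i j; apply: polyfun_ext (polyfunM pc (pA i j)) => l; rewrite mxE. Qed.

Lemma mxpolyfun_const m p (A : 'M_(m, p)) : mxpolyfun (fun=> A).
Proof. by move=> i j; apply: polyfun_const. Qed.

Lemma polyfun_det m (A : dualb K n -> 'M_m) : mxpolyfun A -> polyfun (fun l => \det (A l)).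
Proof.
move=> pA; rewrite /determinant; apply: polyfun_sum => s _.
by apply: polyfunM; [exact: polyfun_const|exact: polyfun_prod].
Qed.

Lemma mxpolyfun_gl : mxpolyfun (fun l : dualb K n => l.1.1).
Proof.
move=> i j; apply: polyfun_ext (polyfun_pairb (delta_mx j i, 0, 0)) => -[[y w] xi].
by rewrite /= !(mulmx0, mul0mx) mxtrace_mul_delta !mxE !addr0.
Qed.

Lemma mxpolyfun_row : mxpolyfun (fun l : dualb K n => l.1.2).
Proof.
move=> i j; apply: polyfun_ext (polyfun_pairb (0, delta_mx j 0, 0)) => -[[y w] xi].
by rewrite /= !(mulmx0, mul0mx) linear0 -colE !mxE addr0 add0r ord1.
Qed.

Lemma mxpolyfun_col : mxpolyfun (fun l : dualb K n => l.2).
Proof.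
move=> i j; apply: polyfun_ext (polyfun_pairb (0, 0, delta_mx 0 i)) => -[[y w] xi].
by rewrite /= !(mulmx0, mul0mx) linear0 -rowE !mxE !add0r ord1.
Qed.

(** Families of polynomials with polynomial coefficients in [l] are closed under products, so the
    Leibniz expansion of the determinant applies. *)
Lemma polyfun_coef_char_poly k : polyfun (fun l : dualb K n => (char_poly l.1.1)`_k).
Proof.
pose coefP (F : dualb K n -> {poly K}) := forall k, polyfun (fun l => (F l)`_k).
have cPM F G : coefP F -> coefP G -> coefP (fun l => F l * G l).
  move=> pF pG e; apply: (@polyfun_ext _ (fun l => \sum_(i < e.+1) (F l)`_i * (G l)`_(e - i))).
    by move=> l; rewrite coefM.
  by apply: polyfun_sum => i _; apply: polyfunM.
have cPC c : coefP (fun=> c) by move=> e; apply: polyfun_const.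
suff cP : coefP (fun l => char_poly l.1.1) by exact: cP.
move=> e; apply: (@polyfun_ext _ (fun l : dualb K n =>
  \sum_(s : {perm 'I_n}) ((-1) ^+ s * \prod_i char_poly_mx l.1.1 i (s i))`_e)) => [l|].
  by rewrite /char_poly /determinant coef_sum.
apply: polyfun_sum => s _; apply: (cPM) => // {}e.
elim: (index_enum _) e => [|i r IHr] e.
  by apply: polyfun_ext (cPC 1 e) => l; rewrite big_nil.
apply: (@polyfun_ext _ (fun l : dualb K n =>
  (char_poly_mx l.1.1 i (s i) * \prod_(j <- r) char_poly_mx l.1.1 j (s j))`_e)) => [l|].
  by rewrite big_cons.
apply: (cPM) => // {}e; rewrite /char_poly_mx.
apply: (@polyfun_ext _ (fun l : dualb K n => ('X *+ (i == s i))`_e - l.1.1 i (s i) *+ (e == 0)%N)).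
  by move=> l; rewrite !mxE coefB coefC; case: (e == 0)%N.
apply: polyfunD; first exact: polyfun_const.
apply: polyfunN; case: (e == 0)%N; first exact: mxpolyfun_gl.
exact: polyfun_const.
Qed.

End PolynomialFunctions.

(** * The bordered matrix *)

Section Generators.
Variables (K : fieldType) (n' : nat).
Local Notation n := n'.+1.
Local Notation "A ^C" := (map_mx (@polyC K) A) (at level 1, format "A ^C").
Implicit Types (l : dualb K n) (y : 'M[K]_n) (w : 'rV[K]_n) (xi : 'cV[K]_n).

Lemma char_polyE y :
  char_poly y = 'X^n - \sum_(j < n) pcoef j.+1 y *: 'X^(n - j.+1).
Proof.
rewrite -{1}[char_poly y]coefK size_char_poly poly_def big_ord_recr /=.
have -> : (char_poly y)`_n = 1.
  by have /monicP := char_poly_monic y; rewrite lead_coefE size_char_poly.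
rewrite scale1r addrC -sumrN; congr (_ + _).
rewrite (reindex_inj rev_ord_inj); apply: eq_bigr => j _ /=.
by rewrite /pcoef scaleNr opprK.
Qed.

Lemma BmxE k y : Bmx k y = y ^+ k - \sum_(j < k) pcoef j.+1 y *: y ^+ (k - j.+1).
Proof. by rewrite /Bmx big_add1 big_mkord. Qed.

Lemma Bmx0 y : Bmx 0 y = 1%:M.
Proof. by rewrite BmxE big_ord0 subr0. Qed.

(** The [Bmx k y] are the successive stages of Horner's scheme for [char_poly y] at [y]. *)
Lemma BmxS k y : Bmx k.+1 y = y *m Bmx k y - (pcoef k.+1 y)%:M.
Proof.
rewrite !BmxE big_ord_recr /= subnn expr0 opprD addrA; congr (_ - _); last first.
  by rewrite scalemx1.
rewrite mulmxBr -[y *m y ^+ k]exprS; congr (_ - _); rewrite mulmx_sumr.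
by apply: eq_bigr => j _; rewrite -scalemxAr subSn // exprS.
Qed.

(** The last stage of Horner's scheme is the characteristic polynomial at [y], zero by
    Cayley-Hamilton. *)
Lemma Bmx_size y : Bmx n y = 0.
Proof.
rewrite BmxE -[RHS](Cayley_Hamilton y) char_polyE raddfB /= rmorphXn /= horner_mx_X.
congr (_ - _); rewrite raddf_sum; apply: eq_bigr => j _ /=.
by rewrite linearZ /= rmorphXn /= horner_mx_X.
Qed.

(** This is the adjugate of t - y, expanded in powers of t. *)
Definition Bpoly y : 'M[{poly K}]_n := \sum_(k < n) 'X^(n - k.+1) *: (Bmx k y)^C.

Lemma char_poly_mx_Bpoly y : char_poly_mx y *m Bpoly y = (char_poly y)%:M.
Proof.
(* By [BmxS] the product telescopes through [f], with ends [f 0], which gives the leading term, and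
   [f n], zero by [Bmx_size]. *)
pose f k := - ('X^(n - k) *: (Bmx k y)^C).
have step (k : 'I_n) : char_poly_mx y *m ('X^(n - k.+1) *: (Bmx k y)^C) =
    (f k.+1 - f k) - (pcoef k.+1 y *: 'X^(n - k.+1))%:M.
  rewrite /f /char_poly_mx mulmxBl mul_scalar_mx scalerA -exprS -subSn // subSS.
  rewrite -scalemxAr -map_mxM /=.
  have -> : y *m Bmx k y = Bmx k.+1 y + (pcoef k.+1 y)%:M by rewrite BmxS subrK.
  rewrite (map_mxD _ (Bmx k.+1 y)) map_scalar_mx scalerDr opprK opprD addrA [- _ + _ in RHS]addrC.
  by rewrite scale_scalar_mx -mul_polyC mulrC.
rewrite /Bpoly mulmx_sumr (eq_bigr _ (fun k _ => step k)) sumrB.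
rewrite -(big_mkord xpredT (fun k => f k.+1 - f k)) telescope_sumr // /f.
rewrite Bmx_size map_mx0 scaler0 oppr0 sub0r opprK subn0 Bmx0 map_scalar_mx.
by rewrite scale_scalar_mx mulr1 -raddf_sum -raddfB -char_polyE.
Qed.

Definition bordered l : 'M[{poly K}]_(n + 1) :=
  block_mx (char_poly_mx l.1.1) l.2^C l.1.2^C 0.

(** A Schur complement without division: the last column is scaled by [char_poly y] and cleared with
    [Bpoly y], and the monic factor is cancelled from the determinants. *)
Lemma det_bordered l : \det (bordered l) = - \sum_(k < n) Fb k l *: 'X^(n - k.+1).
Proof.
case: l => [[y w] xi]; rewrite /bordered /=.
pose c : 'M[{poly K}]_1 := w^C *m Bpoly y *m xi^C.
have : block_mx (char_poly_mx y) xi^C w^C 0 *m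
    block_mx 1%:M (- (Bpoly y *m xi^C)) 0 (char_poly y)%:M =
    block_mx (char_poly_mx y) 0 w^C (- c).
  rewrite mulmx_block !mulmx0 !mul0mx !mulmx1 !addr0 !mulmxN !mulmxA.
  by rewrite char_poly_mx_Bpoly mul_scalar_mx mul_mx_scalar addNr.
move/(congr1 determinant); rewrite det_mulmx det_ublock det_lblock det1 mul1r.
rewrite det_scalar1 -/(char_poly y) mulrC.
move/(mulfI (monic_neq0 (char_poly_monic y))) ->.
rewrite det_mx11 mxE; congr (- _); rewrite /c /Bpoly mulmx_sumr mulmx_suml summxE.
apply: eq_bigr => k _; rewrite -scalemxAr -scalemxAl -!map_mxM mxE mxE.
by rewrite mulrC mul_polyC.
Qed.

Lemma Fb_coef_det_bordered k l : (k < n)%N -> Fb k l = - (\det (bordered l))`_(n - k.+1).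
Proof.
move=> lt_k; rewrite det_bordered coefN opprK coef_sum (bigD1 (Ordinal lt_k)) //=.
rewrite big1 => [|j]; first by rewrite addr0 coefZ coefXn eqxx mulr1.
rewrite -val_eqE /= coefZ coefXn => nej; case: eqP => [|_]; last by rewrite mulr0.
move=> ejk; case/eqP: nej; have lt_j := ltn_ord j.
have := congr1 (subn n) ejk; rewrite !subKn //; by case.
Qed.

Lemma bordered_coAdb b l (g := glB b) :
  bordered (coAdb b l) =
  block_mx g^C (- (vecB b)^C) 0 1%:M *m bordered l
    *m block_mx (invmx g)^C 0 (covB b)^C 1%:M.
Proof.
have gg : g^C *m (invmx g)^C = 1%:M by rewrite -map_mxM mulmxV ?glB_unit // map_mx1.
case: l => [[y w] xi]; rewrite coAdbE -/g /bordered /= !mulmx_block.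
rewrite !(mulmx0, mul0mx, mulmx1, mul1mx, addr0, add0r) !map_mxM; congr block_mx.
rewrite /char_poly_mx map_mxB map_mxD !map_mxM mulmxBr mulmxDl mulmxBl mulNmx.
rewrite mul_mx_scalar -[in RHS]scalemxAl gg scalemx1 !mulNmx /=.
by rewrite !opprD opprK !addrA.
Qed.

Lemma Fb_coAd_invariant k : (k < n)%N -> coAd_invariant (@Fb K n k).
Proof.
move=> lt_k b l; rewrite !Fb_coef_det_bordered // bordered_coAdb !det_mulmx.
rewrite det_ublock det_lblock !det1 !mulr1 mulrC mulrA -det_mulmx -map_mxM.
by rewrite mulVmx ?glB_unit // map_mx1 det1 mul1r.
Qed.

Lemma mxpolyfun_Bmx k : mxpolyfun (fun l => Bmx k l.1.1).
Proof.
elim: k => [|k IHk].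
  by move=> i j; apply: polyfun_ext (polyfun_const n ((1%:M : 'M[K]_n) i j)) => l; rewrite Bmx0.
have pM := mxpolyfunD (mxpolyfunM (@mxpolyfun_gl K n) IHk)
  (mxpolyfunZ (polyfun_coef_char_poly K n (n - k.+1)) (mxpolyfun_const n 1%:M)).
move=> i j; apply: polyfun_ext (pM i j) => l.
by rewrite BmxS /pcoef scalemx1 raddfN opprK.
Qed.

Lemma polyfun_Fb k : polyfun (@Fb K n k).
Proof.
have pF := mxpolyfunM (mxpolyfunM (@mxpolyfun_row K n) (mxpolyfun_Bmx k)) (@mxpolyfun_col K n).
by apply: polyfun_ext (pF 0 0) => -[[y w] xi].
Qed.

End Generators.

(** * The slice *)

Section Slice.
Variables (K : fieldType) (n' : nat).
Local Notation n := n'.+1.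
Implicit Types (l : dualb K n) (y : 'M[K]_n) (w : 'rV[K]_n) (xi : 'cV[K]_n).

Definition shiftmx : 'M[K]_n := \matrix_(i, j) (i == j.+1 :> nat)%:R.

Definition slice (c : 'rV[K]_n) : dualb K n := (shiftmx, c, delta_mx 0 0).

(** Invertible exactly when [l.2] is a cyclic vector for [l.1.1]. *)
Definition krylov l : 'M[K]_n := \matrix_(i, j) (Bmx j l.1.1 *m l.2) i 0.

Definition Frow l : 'rV[K]_n := \row_j Fb j l.

Definition pcoef_row y : 'rV[K]_n := \row_j pcoef j.+1 y.

Lemma mul_krylov l :
  l.1.1 *m krylov l = krylov l *m shiftmx + l.2 *m pcoef_row l.1.1.
Proof.
case: l => [[y w] xi] /=; apply/matrixP => i j.
have -> : (y *m krylov (y, w, xi)) i j = (y *m Bmx j y *m xi) i 0.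
  by rewrite -mulmxA !mxE; apply: eq_bigr => k _; rewrite [(krylov _) _ _]mxE.
have -> : y *m Bmx j y = Bmx j.+1 y + (pcoef j.+1 y)%:M by rewrite BmxS subrK.
rewrite mulmxDl mul_scalar_mx [LHS]mxE [RHS]mxE; congr (_ + _); last first.
  by rewrite !mxE big_ord1 mxE mulrC.
rewrite [RHS]mxE; have [lt_j|le_j] := ltnP j.+1 n.
  rewrite (bigD1 (Ordinal lt_j)) //= big1 => [|k].
    by rewrite [shiftmx _ _]mxE eqxx mulr1 addr0 [RHS]mxE.
  by rewrite -val_eqE [shiftmx _ _]mxE /= => /negPf ->; rewrite mulr0.
(* In the last column the shift contributes nothing, which matches B_n(y) = 0. *)
have -> : j.+1 = n by apply/eqP; rewrite eqn_leq le_j ltn_ord.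
rewrite Bmx_size mul0mx mxE big1 // => k _.
by rewrite [shiftmx _ _]mxE ltn_eqF ?mulr0 // (leq_trans (ltn_ord k)).
Qed.

Lemma row_mul_krylov l : l.1.2 *m krylov l = Frow l.
Proof.
case: l => [[y w] xi]; apply/rowP => j; rewrite [RHS]mxE /Fb -mulmxA !mxE.
by apply: eq_bigr => k _; rewrite [(krylov _) _ _]mxE.
Qed.

Lemma krylov_col0 l : krylov l *m delta_mx 0 0 = l.2.
Proof. by apply/colP => i; rewrite -colE [LHS]mxE [LHS]mxE Bmx0 mul1mx. Qed.

(** With g the inverse of [krylov l], [mul_krylov] turns y into the shift plus e_0 p, where p is
    [pcoef_row l.1.1]; as g xi = e_0, the covector part p subtracts the second term. *)
Lemma coAdb_krylov l (U : krylov l \in unitmx) (U' : invmx (krylov l) \in unitmx) :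
  coAdb (GrpB U' 0 (pcoef_row l.1.1)) l = slice (Frow l).
Proof.
have yG := mul_krylov l; have wG := row_mul_krylov l; have e0 := krylov_col0 l.
set G := krylov l in U U' yG wG e0 *.
case: l => [[y w] xi] /= in G U U' yG wG e0 *.
rewrite coAdbE /= invmxK !mul0mx addr0 wG -[_ *m y *m G]mulmxA yG -e0.
by rewrite mulmxDr !mulmxA mulVmx // !mul1mx addrK.
Qed.

Lemma pcoef_shiftmx j : (j < n)%N -> pcoef j.+1 shiftmx = 0.
Proof.
move=> lt_j; rewrite /pcoef char_poly_trig; last first.
  apply/is_trig_mxP => i k lt_ik; rewrite mxE; case: eqP => // eq_ik.
  by move: lt_ik; rewrite eq_ik ltnNge leqnSn.
rewrite (eq_bigr (fun=> 'X)) => [|i _]; last by rewrite mxE ltn_eqF ?subr0.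
rewrite prodr_const card_ord coefXn; case: eqP => [e|_]; last by rewrite oppr0.
by have := leq_subr j n'; rewrite -subSS e ltnn.
Qed.

(** All [pcoef] of the shift N vanish, so B_k(N) e_0 = N^k e_0 = e_k. *)
Lemma krylov_slice c : krylov (slice c) = 1%:M.
Proof.
suff E k : (k < n)%N -> Bmx k shiftmx *m delta_mx 0 0 = \col_i (i == k :> nat)%:R :> 'cV[K]_n.
  by apply/matrixP => i j; rewrite mxE E // !mxE.
elim: k => [|k IHk] lt_k; first by rewrite Bmx0 mul1mx; apply/colP => i; rewrite !mxE andbT.
rewrite BmxS pcoef_shiftmx ?(ltnW lt_k) // raddf0 subr0 -mulmxA IHk ?(ltnW lt_k) //.
apply/colP => i; rewrite !mxE (bigD1 (Ordinal (ltnW lt_k))) //= !mxE eqxx mulr1.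
rewrite big1 ?addr0 // => j; rewrite -val_eqE /= !mxE => /negPf ->.
by rewrite mulr0.
Qed.

Lemma Fb_slice c (k : 'I_n) : Fb k (slice c) = c 0 k.
Proof.
by have := row_mul_krylov (slice c); rewrite krylov_slice mulmx1 => /rowP/(_ k) ->; rewrite mxE.
Qed.

Lemma slice_polynomial (p : Symb K n) :
  exists P : {mpoly K[n]}, forall c : 'rV[K]_n, evS p (slice c) = P.@[fun k => c 0 k].
Proof.
(* Each coordinate of [slice c] is affine in [c]; substituting these affine forms in [p] gives P. *)
pose lq i : {mpoly K[n]} :=
  (pairb (slice 0) (basisb K i))%:MP + \sum_k (basisb K i).1.2 k 0 *: 'X_k.
exists (p \mPo [tuple lq i | i < dimb n]) => c.
rewrite comp_mpoly_meval; apply: meval_eq => i; rewrite tnth_mktuple mevalD mevalC.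
rewrite raddf_sum /=; case: (basisb K i) => [[x u] v] /=.
rewrite mul0mx [(0 : 'M_1) 0 0]mxE addr0 addrAC; congr (_ + _); rewrite mxE.
by apply: eq_bigr => k _; rewrite mevalZ mevalXU mulrC.
Qed.

Hypothesis K0 : [pchar K] =i pred0.

Lemma Fb_alg_independent : alg_independent (fun k : 'I_n => @Fb K n k).
Proof.
move=> P P0; apply: (mpoly_eq0_meval K0) => v.
rewrite -(P0 (slice (\row_k v k))); apply: meval_eq => k.
by rewrite Fb_slice mxE.
Qed.

Lemma invariant_in_subalg (f : dualb K n -> K) :
  polyfun f /\ coAd_invariant f <-> in_subalg (fun k : 'I_n => @Fb K n k) f.
Proof.
split=> [[pf inv_f]|[P fP]]; last first.
  split; first by apply: polyfun_in_subalg (ex_intro _ P fP) => k; apply: polyfun_Fb.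
  by move=> b l; rewrite !fP; apply: meval_eq => k; apply: Fb_coAd_invariant.
have [p fp] := pf; have [P PE] := slice_polynomial p; exists P => l.
have pFP : polyfun (fun l' => P.@[fun k : 'I_n => Fb k l']).
  by apply: (polyfun_in_subalg (fun k => @polyfun_Fb K n' k)); exists P.
have pdet : polyfun (fun l' => \det (krylov l')).
  apply: polyfun_det => i j.
  have pBxi := mxpolyfunM (@mxpolyfun_Bmx K n' j) (@mxpolyfun_col K n).
  by apply: polyfun_ext (pBxi i 0) => l'; rewrite mxE.
apply/eqP; rewrite -subr_eq0; apply/eqP; move: l.
(* The dense set is the locus where [krylov] is invertible; it contains the slice, on which [krylov]
   is the identity. *)
apply: (polyfun_mul_eq0 K0 (l0 := slice 0) (polyfunD pf (polyfunN pFP)) pdet) => [l U|].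
  rewrite -unitfE -unitmxE in U; have U' : invmx (krylov l) \in unitmx by rewrite unitmx_inv.
  rewrite -(inv_f (GrpB U' 0 (pcoef_row l.1.1))) coAdb_krylov // fp PE.
  apply/eqP; rewrite subr_eq0; apply/eqP/meval_eq => k; by rewrite mxE.
by rewrite krylov_slice det1 oner_eq0.
Qed.

End Slice.

(** * The theorem over the complex numbers *)

Local Open Scope complex_scope.
Theorem mainTheorem1 (R : realType) (n : nat) (hn : (0 < n)%N) :
  let F := fun k : 'I_n => @Fb R[i] n k in
  [/\ forall k : 'I_n, polyfun (F k),
      forall k : 'I_n, coAd_invariant (F k),
      alg_independent F,
      forall f : dualb R[i] n -> R[i], Yb f <-> in_subalg F f
    & forall f : dualb R[i] n -> R[i],
        polyfun f /\ coAd_invariant f <-> in_subalg F f].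
Proof.
case: n hn => // n _ F; have K0 := Num.Theory.pchar_num R[i].
split=> [k|k||f|f].
- exact: polyfun_Fb.
- exact: Fb_coAd_invariant.
- exact: Fb_alg_independent.
- by rewrite Yb_coAd_invariant // invariant_in_subalg.
- exact: invariant_in_subalg.
Qed.
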